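(* (a) Suppose that for every $y_0\in Y$ the limit $V(y_0):=\lim_{T\to\infty}V_T(y_0)$ exists, and that the function $V(\cdot)$ is continuous on $Y$. Then $V(y_0)=d^*(y_0)$ for all $y_0\in Y$. (b) Suppose that for every $y_0\in Y$ the limit $h(y_0):=\lim_{\alpha\to1}h_\alpha(y_0)$ exists, and that $h(\cdot)$ is continuous on $Y$. Then $h(y_0)=d^*(y_0)$ for all $y_0\in Y$.
   Context: Let $Y\subset\mathbb{R}^m$ be nonempty compact, $U_0$ a compact metric space, $U(\cdot):Y\rightsquigarrow U_0$ upper semicontinuous and compact-valued, and $f:\mathbb{R}^m\times U_0\to\mathbb{R}^m$, $k:\mathbb{R}^m\times U_0\to\mathbb{R}$ continuous. Put $A(y):=\{u\in U(y): f(y,u)\in Y\}$ and $G:=\{(y,u):y\in Y,\ u\in A(y)\}$. Standing assumption: $A(y)\ne\emptyset$ for all $y\in Y$. For $y_0\in Y$, an admissible process on $\{0,\dots,T-1\}$ (respectively on $\{0,1,\dots\}$) is a pair $(y(t),u(t))$ with $y(0)=y_0$, $u(t)\in A(y(t))$ and $y(t+1)=f(y(t),u(t))$. The controls form $\mathcal U_T(y_0)$ (respectively $\mathcal U(y_0)$). Value functions: $$V_T(y_0):=\frac1T\min_{u\in\mathcal U_T(y_0)}\sum_{t=0}^{T-1}k(y(t),u(t)),\qquad h_\alpha(y_0):=(1-\alpha)\min_{u\in\mathcal U(y_0)}\sum_{t=0}^\infty\alpha^tk(y(t),u(t)).$$ Dual value: $d^*(y_0):=\sup\mu$, where the supremum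 is over triples $(\mu,\psi,\eta)\in\mathbb{R}\times C(Y)\times C(Y)$ with, for all $(y,u)\in G$: $$k(y,u)+\psi(y_0)-\psi(y)+\eta(f(y,u))-\eta(y)-\mu\ge0,\qquad\psi(f(y,u))-\psi(y)\ge0.$$ *)

(* Defs.v *)
From HB Require Import structures.
From mathcomp Require Import all_boot all_order all_algebra.
From mathcomp Require Import all_classical all_reals all_analysis.
Set Implicit Arguments. Unset Strict Implicit. Unset Printing Implicit Defensive.
Import Order.TTheory GRing.Theory Num.Theory.
Import numFieldNormedType.Exports.
Local Open Scope classical_set_scope.
Local Open Scope ring_scope.

Section OCP.
Variables (R : realType) (m : nat) (U0 : metricType R).
Implicit Types (Y : set 'rV[R]_m) (U : 'rV[R]_m -> set U0)
  (f : 'rV[R]_m -> U0 -> 'rV[R]_m) (k : 'rV[R]_m -> U0 -> R).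

Definition usc_on Y U :=
  forall y, Y y -> forall O : set U0, open O -> U y `<=` O ->
    \forall y' \near y, Y y' -> U y' `<=` O.

Definition Aset Y U f (y : 'rV[R]_m) : set U0 := [set u | U y u /\ Y (f y u)].

Fixpoint traj f (y0 : 'rV[R]_m) (u : nat -> U0) (t : nat) : 'rV[R]_m :=
  match t with
  | 0 => y0
  | t'.+1 => f (traj f y0 u t') (u t')
  end.

(* admissible controls on {0,...,T-1} (values for t >= T are irrelevant) *)
Definition admissibleT Y U f y0 (T : nat) : set (nat -> U0) :=
  [set u | forall t, (t < T)%N -> Aset Y U f (traj f y0 u t) (u t)].

Definition admissible Y U f y0 : set (nat -> U0) :=
  [set u | forall t, Aset Y U f (traj f y0 u t) (u t)].

Definition VT Y U f k (T : nat) (y0 : 'rV[R]_m) : R :=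
  (T%:R)^-1 * inf [set \sum_(t < T) k (traj f y0 u t) (u t)
                   | u in admissibleT Y U f y0 T].

Definition halpha Y U f k (alpha : R) (y0 : 'rV[R]_m) : R :=
  (1 - alpha) * inf [set limn (series (fun t => alpha ^+ t * k (traj f y0 u t) (u t)))
                     | u in admissible Y U f y0].

Definition dual_feasible Y U f k (y0 : 'rV[R]_m) (mu : R) : Prop :=
  exists psi eta : 'rV[R]_m -> R,
    {within Y, continuous psi} /\ {within Y, continuous eta} /\
    forall y u, Y y -> Aset Y U f y u ->
      0 <= k y u + psi y0 - psi y + eta (f y u) - eta y - mu /\
      0 <= psi (f y u) - psi y.

Definition dstar Y U f k (y0 : 'rV[R]_m) : \bar R :=
  ereal_sup [set mu%:E | mu in dual_feasible Y U f k y0].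

End OCP.

(* Main.v *)
Require Import Defs.
From HB Require Import structures.
From mathcomp Require Import all_boot all_order all_algebra.
From mathcomp Require Import all_classical all_reals all_analysis.
From mathcomp Require Import ring lra.
Import Order.TTheory GRing.Theory Num.Theory.
Import numFieldNormedType.Exports.
Local Open Scope classical_set_scope.
Local Open Scope ring_scope.

(* d* <= V is weak duality: psi is nondecreasing along admissible processes, so a
   feasible (mu, psi, eta) bounds every sum of k below by T mu + eta(y_0) - eta(y_T).

   For V <= d*, take psi = V, which is nondecreasing along admissible processes by
   dynamic programming. What is needed is a continuous eta with
   eta(y) <= k(y,u) - V(y) + e + eta(f(y,u)) on G. Value functions of the control
   system are only lower semicontinuous, so eta is defined as the infimum of
   sum_t (k - V + e + n |y_{t+1} - f(y_t,u_t)|) over all finite sequences in G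
   whose jumps are penalised; the infimum is automatically n-Lipschitz. If it were
   -oo for every n, cutting very negative sequences at the peak of their prefix
   sums and letting n -> oo would give, by compactness of G^N, a genuine admissible
   process all of whose partial sums of k - V + e are <= 0. Started from a time
   where V is nearly maximal along it, this process has Cesaro and Abel means of k
   asymptotically below V - e/2 at its initial point, a contradiction. *)

Set Implicit Arguments.
Unset Strict Implicit.

(** * Limits of paths in a compact set, and peaks of prefix sums *)

(** By Tychonoff the paths [q n] cluster at some [p] in the product, and closed sublevel sets of
    [Phi] retain cluster points. The cluster point replaces a diagonal subsequence. *)
Lemma compact_sequence_limit (R : realType) (T : topologicalType) (K : set T)
    (q : nat -> nat -> T) :
  compact K -> (forall n t, K (q n t)) ->
  exists p : nat -> T, (forall t, K (p t)) /\
    forall (Phi : prod_topology (fun _ : nat => T) -> R) (c : R),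
      continuous Phi -> (\forall n \near \oo, Phi (q n) <= c) -> Phi p <= c.
Proof.
move=> cK qK.
have cP := @tychonoff nat (fun _ => T) (fun _ => K) (fun _ => cK).
pose F := (q : nat -> prod_topology (fun _ : nat => T)) @ \oo.
have PF : ProperFilter F by exact: fmap_proper_filter.
have FK : F [set f : nat -> T | forall i, K (f i)].
  by exists 0%N => // n _ t; exact: qK.
have [p [Kp clp]] := cP F PF FK.
exists p; split => // Phi c cPhi nc.
have clS : closed (Phi @^-1` [set x | x <= c]).
  by move/continuous_closedP: cPhi; apply; exact: closed_le.
apply: clS => B nB; move: (clp (Phi @^-1` [set x | x <= c]) B).
by apply => //; exact: nc.
Qed.

(* Cutting a very negative path at the place where its prefix sums peak leaves
   a tail with nonpositive prefix sums. *)
Lemma tail_below_peak (R : realType) (a : nat -> R) (M : R) (L n : nat) :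
  0 <= M -> (forall t, - M <= a t) -> \sum_(t < L) a t < - (n%:R * M) ->
  exists s, forall l, (l <= n)%N -> \sum_(t < l) a (s + t)%N <= 0.
Proof.
move=> M0 aM SL; pose S i := \sum_(t < i) a t.
have Sadd s l : S (s + l)%N = S s + \sum_(t < l) a (s + t)%N.
  by rewrite /S big_split_ord.
have [s _ smax] := @arg_maxP _ _ _ (@ord0 L) predT (fun i => S i) isT.
exists s => l ln; have [sl|] := leqP (s + l) L.
  have := smax (inord (s + l)) isT.
  by rewrite inordK// Sadd/= gerDl.
(* A window running past [L] cannot occur: fewer than [n] terms would remain, losing at most [n * M]
   from a peak that is at least the empty sum 0. *)
move=> Lsl; exfalso; move: SL; apply/negP; rewrite -leNgt.
have sL : (s <= L)%N by rewrite -ltnS.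
have -> : \sum_(t < L) a t = S s + \sum_(t < L - s) a (s + t)%N.
  by rewrite -Sadd subnKC.
have S0 : 0 <= S s by have := smax ord0 isT; rewrite /S /= big_ord0.
have : \sum_(t < L - s) a (s + t)%N >= \sum_(t < L - s) (- M) by apply: ler_sum.
rewrite sumr_const card_ord => h.
have : (L - s)%:R <= (n%:R : R) by rewrite ler_nat leq_subLR (leq_trans (ltnW Lsl))// leq_add2l.
move=> h2; rewrite -mulr_natl in h.
have : (L - s)%:R * M <= n%:R * M by apply: ler_wpM2r.
lra.
Qed.

Lemma continuous_compact_bounded (R : realType) (T : topologicalType)
    (K : set T) (g : T -> R) : compact K -> {within K, continuous g} ->
  exists M, 0 <= M /\ forall x, K x -> `|g x| <= M.
Proof.
move=> cK cg; have := continuous_compact cg cK.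
move=> /(@compact_bounded R R)[M [_ hM]].
exists (`|M| + 1); split => [|x Kx]; first by rewrite addr_ge0.
by apply: hM; [rewrite (le_lt_trans (ler_norm _))// ltrDl|exists x].
Qed.

(** * Continuous potentials from penalised paths *)

Section penalised_potential.
Variables (R : realType) (T : topologicalType) (W : normedModType R).
Variables (K : set T) (s F : T -> W) (g : T -> R).
Hypotheses (cK : compact K) (cs : continuous s) (cF : continuous F)
  (cg : continuous g).

(** Points of [K] act as transitions with source [s] and target [F]; a path is a genuine trajectory
    exactly when all its jumps vanish. *)
Let jump (p : nat -> T) (t : nat) : R := `|s (p t.+1) - F (p t)|.

Let continuous_coord (Z : topologicalType) (G : T -> Z) t : continuous G ->
  continuous (fun p : prod_topology (fun _ : nat => T) => G (p t)).
Proof.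
move=> cG p.
exact: (continuous_comp (@proj_continuous _ (fun _ : nat => T) t p) (cG _)).
Qed.

Let continuous_jump t :
  continuous (fun p : prod_topology (fun _ : nat => T) => jump p t).
Proof.
move=> p.
exact: cvg_norm (cvgB (@continuous_coord _ _ t.+1 cs p) (@continuous_coord _ _ t cF p)).
Qed.

Let continuous_path_sum l :
  continuous (fun p : prod_topology (fun _ : nat => T) => \sum_(t < l) g (p t)).
Proof.
elim: l => [|l ih].
  have -> : (fun p : prod_topology (fun _ : nat => T) => \sum_(t < 0) g (p t)) =
    cst 0 by apply/funext => p; rewrite big_ord0.
  exact: cst_continuous.
have -> : (fun p : prod_topology (fun _ : nat => T) => \sum_(t < l.+1) g (p t)) =
  (fun p => \sum_(t < l) g (p t) + g (p l)).
  by apply/funext => p; rewrite big_ord_recr.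
move=> p; exact: cvgD (ih p) (@continuous_coord _ _ l cg p).
Qed.

(** One penalty and one bound serve all paths and lengths, which makes the infimum defining the
    potential finite. *)
Lemma penalised_sums_bounded :
  (forall p : nat -> T, (forall t, K (p t)) ->
     (forall t, s (p t.+1) = F (p t)) -> exists l, 0 < \sum_(t < l) g (p t)) ->
  exists n : nat, exists B : R, forall p : nat -> T, (forall t, K (p t)) ->
    forall l, B <= \sum_(t < l) (g (p t) + n%:R * jump p t).
Proof.
move=> pos; apply: contrapT => unb.
have [M [M0 absM]] := continuous_compact_bounded cK (continuous_subspaceT cg).
have gM x : K x -> - M <= g x by move=> /absM; rewrite ler_norml => /andP[].
have /choice[q qP] : forall n : nat, exists q : nat -> T, (forall t, K (q t)) /\
    forall l, (l <= n)%N -> \sum_(t < l) (g (q t) + n%:R * jump q t) <= 0.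
  (* [- (n * M)] is the threshold of [tail_below_peak]: a path falling below it has a tail that
     could serve as [q n]. *)
  move=> n; apply: contrapT => nq; apply: unb; exists n, (- (n%:R * M)) => p Kp l.
  rewrite leNgt; apply/negP => lt.
  apply: nq; have := @tail_below_peak R (fun t => g (p t) + n%:R * jump p t) M l n M0 _ lt.
  have h t : - M <= g (p t) + n%:R * jump p t.
    by apply: (le_trans (gM _ (Kp t))); rewrite lerDl mulr_ge0 ?ler0n ?normr_ge0.
  move=> /(_ h)[k hk]; exists (fun t => p (k + t)%N); split; first by move=> t; exact: Kp.
  by move=> l' /hk; under eq_bigr do rewrite /jump -addnS.
have [p [Kp pP]] := @compact_sequence_limit R T K q cK (fun n => (qP n).1).
have sum_le0 l : \sum_(t < l) g (p t) <= 0.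
  apply: (pP _ _ (@continuous_path_sum l)).
  near=> n; have ln : (l <= n)%N by near: n; exact: nbhs_infty_ge.
  apply: le_trans ((qP n).2 l ln); apply: ler_sum => t _.
  by rewrite lerDl mulr_ge0 ?ler0n ?normr_ge0.
have jump0 t : s (p t.+1) = F (p t).
  apply/eqP; rewrite -subr_eq0 -normr_le0; apply/ler_addgt0Pr => e e0; rewrite add0r.
  apply: (pP _ _ (@continuous_jump t)).
  near=> n.
  have n0 : 0 < n%:R :> R by rewrite ltr0n; near: n; exact: nbhs_infty_gt.
  have tn : (t.+1 <= n)%N by near: n; exact: nbhs_infty_ge.
  (* The prefix ending with jump [t] has nonpositive sum and its [g]-part is at least
     [- (t.+1 * M)], so that jump is at most [t.+1 * M / n], which tends to 0. *)
  have := (qP n).2 t.+1 tn; rewrite big_split/= -mulr_sumr.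
  have : \sum_(i < t.+1) g (q n i) >= \sum_(i < t.+1) (- M).
    by apply: ler_sum => i _; apply: gM; exact: (qP n).1.
  rewrite sumr_const card_ord -mulr_natl [X in _ + _ * X]big_ord_recr/=.
  have : 0 <= \sum_(i < t) jump (q n) i by apply: sumr_ge0 => i _; exact: normr_ge0.
  move=> h1 h2 h3.
  have : n%:R * jump (q n) t <= t.+1%:R * M.
    have : 0 <= n%:R * \sum_(i < t) jump (q n) i by rewrite mulr_ge0// ltW.
    move: h3; rewrite mulrDr; lra.
  rewrite mulrC -ler_pdivlMr// => /le_trans; apply.
  rewrite ler_pdivrMr// [leRHS]mulrC -ler_pdivrMr//; near: n; exact: nbhs_infty_ger.
by have [l] := pos p Kp jump0; rewrite ltNge sum_le0.
Unshelve. all: by end_near. Qed.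

(** In the cost [c w p l] only the penalty on the initial gap involves [w], so the infimum [eta] is
    Lipschitz. Prepending [x] to a path compared with [F x] gives the inequality. *)
Lemma continuous_potential : K !=set0 ->
  (forall p : nat -> T, (forall t, K (p t)) ->
     (forall t, s (p t.+1) = F (p t)) -> exists l, 0 < \sum_(t < l) g (p t)) ->
  exists eta : W -> R, continuous eta /\
    forall x, K x -> eta (s x) <= g x + eta (F x).
Proof.
move=> [x0 Kx0] /penalised_sums_bounded[n [B hB]].
pose c (w : W) (p : nat -> T) l :=
  n%:R * `|w - s (p 0)| + \sum_(t < l) (g (p t) + n%:R * jump p t).
pose E w := [set c w pl.1 pl.2 | pl in [set pl : (nat -> T) * nat | forall t, K (pl.1 t)]].
have E0 w : E w !=set0 by exists (c w (fun=> x0) 0%N), (fun=> x0, 0%N).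
have Elb w : has_lbound (E w).
  exists B => _ [[p l] /= Kp <-]; rewrite (le_trans (hB p Kp l))// lerDr mulr_ge0//.
pose eta w := inf (E w).
have etale w p l : (forall t, K (p t)) -> eta w <= c w p l.
  by move=> Kp; apply: ge_inf => //; exists (p, l).
have lip w w' : eta w <= eta w' + n%:R * `|w - w'|.
  rewrite -lerBlDr; apply: lb_le_inf => // _ [[p l] /= Kp <-].
  rewrite lerBlDr (le_trans (etale w p l Kp))// /c.
  have : n%:R * `|w - s (p 0%N)| <= n%:R * (`|w - w'| + `|w' - s (p 0%N)|).
    by rewrite ler_wpM2l// ler_distD.
  rewrite mulrDr; lra.
exists eta; split.
  move=> w; apply/cvgrPdist_lt => e e0; near=> w'.
  have h : n%:R * `|w - w'| < e.
    (* The penalty [n] may be 0; [n.+1] is a safe divisor. *)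
    have n0 : 0 < n.+1%:R :> R by [].
    rewrite (@le_lt_trans _ _ (n.+1%:R * `|w - w'|))//; first by rewrite ler_wpM2r// ler_nat.
    rewrite mulrC -ltr_pdivlMr//.
    by near: w'; apply: cvgr_dist_lt; rewrite ?divr_gt0//; exact: cvg_id.
  rewrite ltr_distl; have := lip w w'; have := lip w' w; rewrite (distrC w' w).
  by move=> h1 h2; apply/andP; split; lra.
move=> x Kx; rewrite -lerBlDl; apply: lb_le_inf => // _ [[p l] /= Kp <-].
(* Seen from [s x], the new path has no initial gap, and its first jump is the initial gap of [p]
   seen from [F x]. *)
pose p' t := if t is t'.+1 then p t' else x.
have Kp' t : K (p' t) by case: t.
rewrite lerBlDl; apply: (le_trans (etale (s x) p' l.+1 Kp')).
by rewrite /c /= subrr normr0 mulr0 add0r big_ord_recl /= /jump /= (distrC (s (p 0%N))) !addrA.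
Unshelve. all: by end_near. Qed.

End penalised_potential.

(** * Abel means controlled by partial sums *)

Lemma abel_sum_le (R : realDomainType) (a : nat -> R) (C alpha : R) :
  0 <= alpha <= 1 -> (forall l, \sum_(t < l) a t <= C) ->
  forall l, \sum_(t < l) alpha ^+ t * a t <= C.
Proof.
move=> /andP[al0 al1] aC l.
(* Summation by parts in inductive form: the weighted gap to [C] is carried along, and passing from
   [alpha ^+ l] to [alpha ^+ l.+1] can only shrink it. *)
suff : \sum_(t < l) alpha ^+ t * a t <= C - alpha ^+ l * (C - \sum_(t < l) a t).
  move=> /le_trans; apply; rewrite gerBl mulr_ge0 ?exprn_ge0//.
  by rewrite subr_ge0.
elim: l => [|l ih]; first by rewrite !big_ord0; lra.
rewrite !big_ord_recr/=.
have : alpha ^+ l.+1 * (C - (\sum_(t < l) a t + a l)) <=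
       alpha ^+ l * (C - (\sum_(t < l) a t + a l)).
  rewrite ler_wpM2r//; first by have := aC l.+1; rewrite big_ord_recr/= subr_ge0.
  by rewrite ler_wiXn2l.
lra.
Qed.

Section discounted_sums.
Variables (R : realType) (a : nat -> R) (alpha : R).
Hypothesis alpha01 : 0 < alpha < 1.

Let normr_alpha : `|alpha| < 1.
Proof. by case/andP: alpha01 => a0 a1; rewrite gtr0_norm. Qed.

Lemma is_cvg_discounted (M : R) : (forall t, `|a t| <= M) ->
  cvgn (series (fun t => alpha ^+ t * a t)).
Proof.
move=> aM; apply: normed_cvg.
apply: (@series_le_cvg R _ (geometric M alpha)).
- by move=> t; exact: normr_ge0.
- move=> t; rewrite /geometric /= mulr_ge0 ?exprn_ge0 ?(le_trans _ (aM 0%N))//.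
  by case/andP: alpha01 => /ltW.
- move=> t; rewrite /geometric /= normrM mulrC normrX.
  case/andP: alpha01 => a0 _; rewrite (gtr0_norm a0).
  by rewrite ler_wpM2r ?exprn_ge0// ltW.
- exact: is_cvg_geometric_series.
Qed.

(** Subtracting the constant [c] leaves partial sums bounded by [C], so [abel_sum_le] applies; the
    constant itself has discounted sum [c / (1 - alpha)]. *)
Lemma discounted_sum_le (S c C : R) :
  series (fun t => alpha ^+ t * a t) @ \oo --> S ->
  (forall l, \sum_(t < l) a t <= l%:R * c + C) ->
  (1 - alpha) * S <= c + (1 - alpha) * C.
Proof.
move=> cS aC; case/andP: alpha01 => a0 a1.
have le n : series (fun t => alpha ^+ t * a t) n - series (geometric c alpha) n <= C.
  rewrite !seriesEord /= -sumrB.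
  under eq_bigr do rewrite /geometric /= (mulrC c) -mulrBr.
  apply: (@abel_sum_le _ (fun t => a t - c)); first by rewrite !ltW.
  by move=> l; rewrite sumrB sumr_const card_ord -mulr_natl lerBlDl.
have le_lim : S - c * (1 - alpha)^-1 <= C.
  apply: cvgr_to_le (cvgB cS (@cvg_geometric_series _ c alpha normr_alpha)) _.
  by exists 0%N => // n _; exact: le.
have e : (1 - alpha) * (c * (1 - alpha)^-1) = c by field; rewrite subr_eq0 gt_eqF.
rewrite -{1}e -mulrDr; apply: ler_wpM2l; [by rewrite subr_ge0 ltW|lra].
Qed.

End discounted_sums.

(** * The control system and its dual value *)

Section optimal_control.
Variables (R : realType) (m : nat) (U0 : metricType R).
Variables (Y : set 'rV[R]_m) (U : 'rV[R]_m -> set U0)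
  (f : 'rV[R]_m -> U0 -> 'rV[R]_m) (k : 'rV[R]_m -> U0 -> R).
Hypotheses (hY0 : Y !=set0) (hY : compact Y) (hU0 : compact [set: U0])
  (hUusc : usc_on Y U) (hUcpt : forall y, Y y -> compact (U y))
  (hf : continuous (fun p : 'rV[R]_m * U0 => f p.1 p.2))
  (hk : continuous (fun p : 'rV[R]_m * U0 => k p.1 p.2))
  (hA : forall y, Y y -> Aset Y U f y !=set0).

Definition admissible_graph := [set p : 'rV[R]_m * U0 | Y p.1 /\ Aset Y U f p.1 p.2].

(** The graph is closed in the compact [Y * U0]. For the constraint [U], a point [u] outside [U y]
    has a neighbourhood whose closure misses [U y]; by upper semicontinuity it misses [U y'] for
    [y'] in [Y] near [y]. *)
Lemma compact_admissible_graph : compact admissible_graph.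
Proof.
have clY : closed Y by apply: compact_closed => //; exact: norm_hausdorff.
apply: (@subclosed_compact _ _ (Y `*` setT)); last 2 first.
- exact: compact_setX.
- by move=> p [].
move=> [y u] cl.
have Yy : Y y.
  have : closed ((fst : 'rV[R]_m * U0 -> _) @^-1` Y).
    by apply: (continuous_closedP _).1 => // p; exact: cvg_fst.
  by move=> /(_ (y, u)); apply; apply: closureS cl => p [].
have Yf : Y (f y u).
  have : closed ((fun p : 'rV[R]_m * U0 => f p.1 p.2) @^-1` Y).
    exact: (continuous_closedP _).1.
  by move=> /(_ (y, u)); apply; apply: closureS cl => p [_ []].
split => //; split => //=; apply: contrapT => Uyu.
have clU : closed (U y).
  by apply: compact_closed; [exact: metric_hausdorff|exact: hUcpt].
have [N Nu NU] : exists2 N, nbhs u N & closure N `<=` ~` U y.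
  apply: uniform_regular; apply: open_nbhs_nbhs; split => //.
  exact: closed_openC.
have Oo : open (~` closure N) by apply: closed_openC; exact: closed_closure.
have UO : U y `<=` ~` closure N by move=> v Uv /NU.
have hO := hUusc Yy Oo UO.
have [] := cl ([set y' | Y y' -> U y' `<=` ~` closure N] `*` N).
  by exists ([set y' | Y y' -> U y' `<=` ~` closure N], N).
move=> [y' u'] [[/= Yy' [Uu' _]]] [/(_ Yy') /(_ _ Uu')] /= nN Nu'.
by apply: nN; exact: subset_closure.
Qed.

(** The range includes [T] itself, since [Aset] already requires the successor state to lie in
    [Y]. *)
Lemma traj_in y0 u T : Y y0 -> admissibleT Y U f y0 T u ->
  forall t, (t <= T)%N -> Y (traj f y0 u t).
Proof. by move=> Y0 au [|t] tT //=; case: (au t tT). Qed.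

Definition cons_control (u0 : U0) (u : nat -> U0) (t : nat) : U0 :=
  if t is t'.+1 then u t' else u0.

Lemma traj_cons y u0 u t :
  traj f y (cons_control u0 u) t.+1 = traj f (f y u0) u t.
Proof. by elim: t => //= t <-. Qed.

Lemma admissible_exists y0 : Y y0 -> exists u, admissible Y U f y0 u.
Proof.
move=> Y0.
have /choice[sel selP] : forall y, exists u, Y y -> Aset Y U f y u.
  move=> y; have [Yy|nY] := pselect (Y y).
    by have [u] := hA Yy; exists u.
  by have [y1 Y1] := hY0; have [u _] := hA Y1; exists u.
pose s := fix s t := if t is t'.+1 then f (s t') (sel (s t')) else y0.
have trajE t : traj f y0 (sel \o s) t = s t by elim: t => //= t ->.
have Ys t : Y (s t) by elim: t => //= t /selP[].
by exists (sel \o s) => t; rewrite trajE; exact: selP.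
Qed.

Lemma running_cost_bounded : exists M, 0 <= M /\
  forall y u, Y y -> Aset Y U f y u -> `|k y u| <= M.
Proof.
have [M [M0 kM]] := continuous_compact_bounded compact_admissible_graph
  (continuous_subspaceT hk).
by exists M; split => // y u Yy au; exact: (kM (y, u)).
Qed.

(* The values of the long-run problems enter only through these three
   properties, which Cesaro and Abel means share. *)
Lemma dstar_eq (V : 'rV[R]_m -> R) :
  {within Y, continuous V} ->
  (forall y u, Y y -> Aset Y U f y u -> V y <= V (f y u)) ->
  (forall y c C u, Y y -> admissible Y U f y u ->
     (forall T, \sum_(t < T) k (traj f y u t) (u t) <= T%:R * c + C) ->
     V y <= c) ->
  (forall y c C, Y y ->
     (forall T u, admissibleT Y U f y T u ->
        T%:R * c - C <= \sum_(t < T) k (traj f y u t) (u t)) ->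
     c <= V y) ->
  forall y0, Y y0 -> dstar Y U f k y0 = (V y0)%:E.
Proof.
move=> cV Vmono Vle Vge y0 Yy0; apply/eqP; rewrite eq_le; apply/andP; split.
  apply: ge_ereal_sup => _ [mu [psi [eta [_ [ceta feas]]]] <-]; rewrite lee_fin.
  have [M [M0 etaM]] := continuous_compact_bounded hY ceta.
  apply: (Vge y0 mu (M + M)) => // T u au.
  have Yt := traj_in Yy0 au.
  have psit t : (t <= T)%N -> psi y0 <= psi (traj f y0 u t).
    elim: t => //= t ih tT; apply: (le_trans (ih (ltnW tT))).
    by have [_] := feas _ _ (Yt t (ltnW tT)) (au t tT); rewrite subr_ge0.
  (* Summing the first dual inequality telescopes [eta]; the terms [psi y0 - psi] are nonpositive
     along the process and drop out. *)
  have : T%:R * mu + eta y0 <=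
      \sum_(t < T) k (traj f y0 u t) (u t) + eta (traj f y0 u T).
    have : forall t, (t <= T)%N -> t%:R * mu + eta y0 <=
      \sum_(i < t) k (traj f y0 u i) (u i) + eta (traj f y0 u t).
      elim=> [_|t ih tT]; first by rewrite big_ord0 mul0r.
      rewrite big_ord_recr /= -natr1 mulrDl mul1r.
      have := ih (ltnW tT); have := psit t (ltnW tT).
      have [+ _] := feas _ _ (Yt t (ltnW tT)) (au t tT).
      set S := \sum_(i < t) _; lra.
    exact.
  have := etaM _ Yy0; have := etaM _ (Yt T (leqnn _)).
  rewrite !ler_norml => /andP[_ h1] /andP[h2 _]; lra.
apply/lee_addgt0Pr => e e0; rewrite -leeBlDr// -EFinB.
(* With [psi = V] and this [mu], the value [V y0] cancels from the first constraint, leaving a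
   condition on [eta] independent of [y0]. *)
apply: ereal_sup_ubound; exists (V y0 - e) => //; exists V.
have [M [M0 VM]] := continuous_compact_bounded hY cV.
have clY : closed Y by apply: compact_closed => //; exact: norm_hausdorff.
(* [V] is continuous on [Y] only, whereas the potential needs a running cost continuous everywhere;
   hence a Tietze extension. *)
have [V' [VV' cV' _]] : exists V' : 'rV[R]_m -> R^o,
    [/\ {in Y, V =1 V'}, continuous V' & forall y, `|V' y| <= M + 1].
  apply: continuous_bounded_extension => //; first exact: pseudometric_normal.
    by rewrite ltr_wpDl.
  by move=> y /VM; lra.
pose g (p : 'rV[R]_m * U0) := k p.1 p.2 - V' p.1 + e.
have cg : continuous g.
  move=> p; apply: cvgD; last exact: cvg_cst.
  apply: cvgB; first exact: hk.
  by apply: (@continuous_comp _ _ _ fst V'); [exact: cvg_fst|exact: cV'].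
have gE p : Y p.1 -> g p = k p.1 p.2 - V p.1 + e.
  by move=> Yp; rewrite /g VV'// inE.
have cfst : continuous (fst : 'rV[R]_m * U0 -> _) by move=> p; exact: cvg_fst.
have G0 : admissible_graph !=set0 by have [u au] := hA Yy0; exists (y0, u).
have [|eta [ceta etaP]] := continuous_potential compact_admissible_graph cfst hf cg G0.
  move=> p Gp step; apply: contrapT => /forallNP noL.
  have {}noL l : \sum_(t < l) g (p t) <= 0 by rewrite leNgt; apply/negP.
  have Yp t : Y (p t).1 := (Gp t).1.
  pose E := range (fun t => V (p t).1).
  have ubE : has_ubound E.
    by exists M => _ [t _ <-]; apply: le_trans (ler_norm _) _; exact: VM.
  have hE : has_sup E by split => //; exists (V (p 0%N).1), 0%N.
  have e2 : 0 < e / 2 by rewrite divr_gt0.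
  (* From time [S] on, [V] exceeds its value at [S] by at most [e / 2], half of the margin [e]
     contained in [g]. *)
  have [_ [S _ <-] Ssup] := sup_adherent e2 hE.
  have VS t : V (p t).1 <= V (p S).1 + e / 2.
    have : V (p t).1 <= sup E by apply: ub_le_sup => //; exists t.
    lra.
  pose u t := (p (S + t)%N).2.
  have trE t : traj f (p S).1 u t = (p (S + t)%N).1.
    by elim: t => [|t /= ->]; rewrite ?addn0// addnS -step.
  have au : admissible Y U f (p S).1 u by move=> t; rewrite trE; exact: (Gp _).2.
  (* Sums of [g] up to [S + T] are nonpositive, so those after [S] are at most minus the sum before
     [S]: this is the constant [C]. The conclusion of [Vle] would be [V <= V - e / 2] at the state
     at time [S]. *)
  have := Vle _ (V (p S).1 - e / 2) (- \sum_(t < S) g (p t)) _ (Yp S) au.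
  apply/not_implyP; split; last by apply/negP; rewrite -ltNge; lra.
  move=> T.
  have : \sum_(t < T) k (traj f (p S).1 u t) (u t) <=
         \sum_(t < T) (g (p (S + t)%N) + (V (p S).1 - e / 2)).
    apply: ler_sum => t _; rewrite trE gE// /u.
    by have := VS (S + t)%N; lra.
  rewrite big_split /= sumr_const card_ord -mulr_natl.
  have := noL (S + T)%N; rewrite big_split_ord /=.
  set A := \sum_(i < S) _; set B := \sum_(i < T) _; set D := \sum_(i < T) _; lra.
exists eta; split => //; split; first exact: continuous_subspaceT.
move=> y u Yy au; split; last by rewrite subr_ge0; exact: Vmono.
by have := etaP (y, u) (conj Yy au); rewrite gE//=; lra.
Qed.

Lemma admissibleT_cons y u0 u T : Y y -> Aset Y U f y u0 ->
  admissibleT Y U f (f y u0) T u ->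
  admissibleT Y U f y T.+1 (cons_control u0 u).
Proof. by move=> Yy au0 au [|t] tT; [exact: au0|rewrite traj_cons; exact: au]. Qed.

Lemma admissible_cons y u0 u : Y y -> Aset Y U f y u0 ->
  admissible Y U f (f y u0) u -> admissible Y U f y (cons_control u0 u).
Proof. by move=> Yy au0 au [|t]; [exact: au0|rewrite traj_cons; exact: au]. Qed.

Lemma admissible_bounded M y u : Y y -> admissible Y U f y u ->
  (forall y u, Y y -> Aset Y U f y u -> `|k y u| <= M) ->
  forall t, `|k (traj f y u t) (u t)| <= M.
Proof.
move=> Yy au kM t; apply: kM => //.
by apply: (@traj_in y u t) => // i _; exact: au.
Qed.

(** * Finite-horizon values and Cesaro limits *)

Section finite_horizon.

Let cost T y := [set \sum_(t < T) k (traj f y u t) (u t) | u in admissibleT Y U f y T].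

Lemma has_lbound_cost T y : Y y -> has_lbound (cost T y).
Proof.
move=> Yy; have [M [M0 kM]] := running_cost_bounded.
exists (\sum_(t < T) - M) => _ [u au <-]; apply: ler_sum => t _.
have Yt : Y (traj f y u t) by apply: (traj_in Yy au); exact: ltnW.
by have := kM _ _ Yt (au t (ltn_ord t)); rewrite ler_norml => /andP[].
Qed.

Lemma cost_neq0 T y : Y y -> cost T y !=set0.
Proof.
move=> Yy; have [u au] := admissible_exists Yy.
by exists (\sum_(t < T) k (traj f y u t) (u t)); exists u => // t _; exact: au.
Qed.

Lemma VT_le T y u : Y y -> admissibleT Y U f y T u ->
  VT Y U f k T y <= T%:R^-1 * \sum_(t < T) k (traj f y u t) (u t).
Proof.
move=> Yy au; rewrite /VT ler_wpM2l ?invr_ge0//.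
by apply: ge_inf; [exact: has_lbound_cost|exists u].
Qed.

(** One half of the dynamic programming principle: any control from [f y u0] may be preceded by
    [u0]. *)
Lemma VT_cons T y u0 : Y y -> Aset Y U f y u0 ->
  VT Y U f k T.+1 y <= T.+1%:R^-1 * (k y u0 + T%:R * VT Y U f k T (f y u0)).
Proof.
move=> Yy au0; have Yf := au0.2.
have -> : T%:R * VT Y U f k T (f y u0) = inf (cost T (f y u0)).
  (* At horizon 0 the factor [T] gives 0, and the only cost is the empty sum. *)
  case: T => [|T]; last by rewrite /VT mulrA divff ?mul1r.
  rewrite mul0r; suff -> : cost 0 (f y u0) = [set 0] by rewrite inf1.
  apply/seteqP; split => [_ [u _ <-]|_ ->]; rewrite /= ?big_ord0//.
  by exists (fun=> u0) => //; rewrite big_ord0.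
rewrite [leLHS]/VT ler_wpM2l ?invr_ge0// -lerBlDl.
apply: lb_le_inf; first exact: cost_neq0.
move=> _ [u au <-]; rewrite lerBlDl.
apply: ge_inf; first exact: has_lbound_cost.
exists (cons_control u0 u); first exact: admissibleT_cons.
rewrite big_ord_recl; congr (_ + _); apply: eq_bigr => t _.
by rewrite lift0 -traj_cons.
Qed.

End finite_horizon.

Lemma cvg_natV (c C : R) : c + C * T%:R^-1 @[T --> \oo] --> c.
Proof.
rewrite -[X in _ --> X]addr0; apply: cvgD; first exact: cvg_cst.
rewrite -[X in _ --> X](mulr0 C); apply: cvgM; first exact: cvg_cst.
by rewrite -(cvg_shiftS (fun T => T%:R^-1 : R)); exact: cvg_harmonic.
Qed.

Lemma dstar_cesaro (V : 'rV[R]_m -> R) :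
  (forall y, Y y -> VT Y U f k T y @[T --> \oo] --> V y) ->
  {within Y, continuous V} ->
  forall y, Y y -> dstar Y U f k y = (V y)%:E.
Proof.
move=> limV cV; apply: dstar_eq => //.
- move=> y u Yy au; have [M [M0 kM]] := running_cost_bounded.
  have Yf := au.2.
  (* This is the right side of [VT_cons], rearranged as the value at the successor plus a vanishing
     correction. *)
  have cR : T.+1%:R^-1 * (k y u - VT Y U f k T (f y u)) + VT Y U f k T (f y u)
      @[T --> \oo] --> 0 * (k y u - V (f y u)) + V (f y u).
    apply: cvgD; last exact: limV.
    apply: cvgM; first exact: cvg_harmonic.
    by apply: cvgB; [exact: cvg_cst|exact: limV].
  have cL : VT Y U f k T.+1 y @[T --> \oo] --> V y.
    by rewrite (cvg_shiftS (fun T => VT Y U f k T y)); exact: limV.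
  rewrite mul0r add0r in cR.
  apply: (ler_cvg_to cL cR); exists 0%N => // T _ /=.
  apply: (le_trans (VT_cons T Yy au)); rewrite le_eqVlt; apply/orP; left.
  by apply/eqP; rewrite -[in T%:R](addrK 1 T%:R) natr1; field.
- move=> y c C u Yy au sumle.
  apply: (ler_cvg_to (limV y Yy) (@cvg_natV c C)).
  exists 1%N => // T /= T0.
  apply: (le_trans (@VT_le T y u Yy (fun t _ => au t))).
  by rewrite mulrC ler_pdivrMr ?ltr0n// mulrDl mulfVK ?pnatr_eq0 -?lt0n// mulrC.
- move=> y c C Yy sumge.
  apply: (ler_cvg_to (@cvg_natV c (- C)) (limV y Yy)).
  exists 1%N => // T /= T0.
  rewrite /VT [leRHS]mulrC.
  rewrite ler_pdivlMr ?ltr0n// mulrDl mulfVK ?pnatr_eq0 -?lt0n//.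
  apply: lb_le_inf; first exact: cost_neq0.
  by move=> _ [u au <-]; rewrite mulrC; exact: sumge.
Qed.

(** * Discounted values and Abel limits *)

Section discounted.
Variable alpha : R.
Hypothesis alpha01 : 0 < alpha < 1.

Let term y u t := alpha ^+ t * k (traj f y u t) (u t).
Let cost y := [set limn (series (term y u)) | u in admissible Y U f y].

Let cvg_term y u : Y y -> admissible Y U f y u ->
  series (term y u) @ \oo --> limn (series (term y u)).
Proof.
move=> Yy au; have [M [M0 kM]] := running_cost_bounded.
exact: (is_cvg_discounted alpha01 (admissible_bounded Yy au kM)).
Qed.

(** This is [discounted_sum_le] applied to the negated running cost. *)
Lemma discounted_cost_ge y u c C : Y y -> admissible Y U f y u ->
  (forall T, T%:R * c - C <= \sum_(t < T) k (traj f y u t) (u t)) ->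
  c - (1 - alpha) * C <= (1 - alpha) * limn (series (term y u)).
Proof.
move=> Yy au sumge.
have cN : series (fun t => alpha ^+ t * - k (traj f y u t) (u t)) @ \oo -->
    - limn (series (term y u)).
  have -> : series (fun t => alpha ^+ t * - k (traj f y u t) (u t)) =
    - series (term y u).
    apply/funext => n; rewrite !seriesEord /= fctE -sumrN.
    by apply: eq_bigr => t _; rewrite mulrN.
  exact: cvgN (cvg_term Yy au).
have := @discounted_sum_le _ _ _ alpha01 _ (- c) C cN.
rewrite mulrN => h.
have : - ((1 - alpha) * limn (series (term y u))) <= - c + (1 - alpha) * C.
  by apply: h => l; rewrite sumrN mulrN; have := sumge l; lra.
lra.
Qed.

Let has_lbound_discounted y : Y y -> has_lbound (cost y).
Proof.
move=> Yy; have [M [M0 kM]] := running_cost_bounded.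
case/andP: alpha01 => a0 a1.
exists ((1 - alpha)^-1 * - M) => _ [u au <-].
rewrite ler_pdivrMl ?subr_gt0//.
have := @discounted_cost_ge y u (- M) 0 Yy au; rewrite mulr0 subr0; apply => T.
rewrite subr0 mulr_natl -[X in _ *+ X]card_ord -sumr_const.
apply: ler_sum => t _.
by have := admissible_bounded Yy au kM t; rewrite ler_norml => /andP[].
Qed.

Let discounted_neq0 y : Y y -> cost y !=set0.
Proof.
by move=> Yy; have [u au] := admissible_exists Yy;
  exists (limn (series (term y u))), u.
Qed.

Lemma halpha_le y u c C : Y y -> admissible Y U f y u ->
  (forall T, \sum_(t < T) k (traj f y u t) (u t) <= T%:R * c + C) ->
  halpha Y U f k alpha y <= c + (1 - alpha) * C.
Proof.
move=> Yy au sumle; case/andP: (alpha01) => a0 a1.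
apply: le_trans (discounted_sum_le alpha01 (cvg_term Yy au) sumle).
rewrite /halpha ler_wpM2l ?subr_ge0 ?(ltW a1)//.
by apply: ge_inf; [exact: has_lbound_discounted|exists u].
Qed.

(** The hypothesis concerns finite-horizon controls, as [dstar_eq] supplies it; an infinite
    admissible control restricts to each horizon. *)
Lemma halpha_ge y c C : Y y ->
  (forall T u, admissibleT Y U f y T u ->
     T%:R * c - C <= \sum_(t < T) k (traj f y u t) (u t)) ->
  c - (1 - alpha) * C <= halpha Y U f k alpha y.
Proof.
move=> Yy sumge; case/andP: (alpha01) => a0 a1.
rewrite /halpha -ler_pdivrMl ?subr_gt0//.
apply: lb_le_inf; first exact: discounted_neq0.
move=> _ [u au <-]; rewrite ler_pdivrMl ?subr_gt0//.
by apply: discounted_cost_ge => // T; apply: sumge => t _; exact: au.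
Qed.

Lemma halpha_cons y u0 : Y y -> Aset Y U f y u0 ->
  halpha Y U f k alpha y <=
  (1 - alpha) * k y u0 + alpha * halpha Y U f k alpha (f y u0).
Proof.
move=> Yy au0; case/andP: (alpha01) => a0 a1; have Yf := au0.2.
rewrite /halpha mulrCA -mulrDr ler_wpM2l ?subr_ge0 ?(ltW a1)//.
rewrite -lerBlDl -ler_pdivrMl//.
apply: lb_le_inf; first exact: discounted_neq0.
move=> _ [u au <-]; rewrite ler_pdivrMl// lerBlDl.
have auc := admissible_cons Yy au0 au.
have -> : k y u0 + alpha * limn (series (term (f y u0) u)) =
    limn (series (term y (cons_control u0 u))).
  (* Dropping the first term of the shifted series leaves [alpha] times the series started at
     [f y u0]. *)
  apply/esym/cvg_lim => //; rewrite -(cvg_shiftS (series (term y _))).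
  have -> : (fun n => series (term y (cons_control u0 u)) n.+1) =
      (fun n => k y u0 + alpha * series (term (f y u0) u) n).
    apply/funext => n; rewrite !seriesEord /= big_ord_recl /term expr0 mul1r.
    congr (_ + _); rewrite mulr_sumr; apply: eq_bigr => t _.
    by rewrite lift0 exprS -mulrA -traj_cons.
  apply: cvgD; first exact: cvg_cst.
  by apply: cvgM; [exact: cvg_cst|exact: cvg_term].
by apply: ge_inf; [exact: has_lbound_discounted|exists (cons_control u0 u)].
Qed.

End discounted.

Lemma near1_left01 : \forall alpha \near (1 : R)^'-, 0 < alpha < 1.
Proof.
near=> alpha; apply/andP; split; near: alpha; last exact: nbhs_left_lt.
exact: nbhs_left_gt.
Unshelve. all: by end_near. Qed.

Lemma cvg_1B_left (c C : R) : c + (1 - alpha) * C @[alpha --> 1^'-] --> c.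
Proof.
rewrite -[X in _ --> X]addr0; apply: cvgD; first exact: cvg_cst.
rewrite -[X in _ --> X](mul0r C); apply: cvgM; last exact: cvg_cst.
rewrite -(subrr (1 : R)); apply: cvgB; first exact: cvg_cst.
exact: cvg_at_left_filter.
Qed.

Lemma dstar_abel (h : 'rV[R]_m -> R) :
  (forall y, Y y -> halpha Y U f k alpha y @[alpha --> 1^'-] --> h y) ->
  {within Y, continuous h} ->
  forall y, Y y -> dstar Y U f k y = (h y)%:E.
Proof.
move=> limh ch; apply: dstar_eq => //.
- move=> y u Yy au; have Yf := au.2.
  (* As [alpha] tends to 1 the immediate cost loses its weight, so [halpha_cons] becomes
     monotonicity of [h]. *)
  have cR : (1 - alpha) * k y u + alpha * halpha Y U f k alpha (f y u)
      @[alpha --> 1^'-] --> 0 + 1 * h (f y u).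
    apply: cvgD.
      by under eq_fun do rewrite -[_ * _]add0r; exact: cvg_1B_left.
    by apply: cvgM; [exact: cvg_at_left_filter|exact: limh].
  rewrite mul1r add0r in cR; apply: (ler_cvg_to (limh y Yy) cR).
  by apply: filterS near1_left01 => alpha a01; exact: halpha_cons.
- move=> y c C u Yy au sumle.
  apply: (ler_cvg_to (limh y Yy) (@cvg_1B_left c C)).
  by apply: filterS near1_left01 => alpha a01; exact: halpha_le sumle.
- move=> y c C Yy sumge.
  apply: (ler_cvg_to (@cvg_1B_left c (- C)) (limh y Yy)).
  by apply: filterS near1_left01 => alpha a01; rewrite mulrN; exact: halpha_ge sumge.
Qed.

End optimal_control.

Unset Implicit Arguments.
Set Strict Implicit.

Theorem theorem4p2 (R : realType) (m : nat) (U0 : metricType R)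
  (Y : set 'rV[R]_m) (U : 'rV[R]_m -> set U0)
  (f : 'rV[R]_m -> U0 -> 'rV[R]_m) (k : 'rV[R]_m -> U0 -> R)
  (hY0 : Y !=set0) (hY : compact Y) (hU0 : compact [set: U0])
  (hUusc : usc_on Y U) (hUcpt : forall y, Y y -> compact (U y))
  (hf : continuous (fun p : 'rV[R]_m * U0 => f p.1 p.2))
  (hk : continuous (fun p : 'rV[R]_m * U0 => k p.1 p.2))
  (hA : forall y, Y y -> Aset Y U f y !=set0) :
  (forall V : 'rV[R]_m -> R,
     (forall y0, Y y0 -> VT Y U f k T y0 @[T --> \oo] --> V y0) ->
     {within Y, continuous V} ->
     forall y0, Y y0 -> dstar Y U f k y0 = (V y0)%:E)
  /\
  (forall h : 'rV[R]_m -> R,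
     (forall y0, Y y0 -> halpha Y U f k alpha y0 @[alpha --> 1^'-] --> h y0) ->
     {within Y, continuous h} ->
     forall y0, Y y0 -> dstar Y U f k y0 = (h y0)%:E).
Proof.
split=> [V limV cV|h limh ch]; first exact: dstar_cesaro.
exact: dstar_abel.
Qed.
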